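(* Let $E$ be a Banach space such that $\mathcal{A}(E)$ has a right approximate identity. Then the following are equivalent: (a) the Banach algebra $\mathcal{A}(E)$ is topologically right Noetherian; (b) every closed right ideal of $\mathcal{A}(E)$ is topologically principal; (c) the space $E$ is separable.
   Context: $\mathcal{A}(E)$ is the Banach algebra of approximable operators on $E$, i.e. the operator-norm closure of the bounded finite-rank operators on $E$. A right approximate identity of a Banach algebra $A$ is a (not necessarily bounded) net $(e_\alpha)$ in $A$ with $a e_\alpha\to a$ in norm for every $a\in A$. $A^\sharp$ denotes the (conditional) unitisation of $A$: $A^\sharp=A$ if $A$ is unital, and $A^\sharp$ is $A$ with an identity adjoined otherwise. A closed right ideal $I$ of $A$ is topologically finitely-generated if there exist $n\in\mathbb{N}$ and $x_1,\ldots,x_n\in I$ with $I=\overline{x_1A^\sharp+\cdots+x_nA^\sharp}$ (norm closure), and topologically principal if $I=\overline{xA^\sharp}$ for some $x\in I$. $A$ is topologically right Noetherian if every closed right ideal of $A$ is topologically finitely-generated. *)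

(* Defs.v *)
From HB Require Import structures.
From mathcomp Require Import all_boot all_order all_algebra.
From mathcomp Require Export complex.
From mathcomp Require Import all_classical all_reals all_analysis.

Set Implicit Arguments.
Unset Strict Implicit.
Unset Printing Implicit Defensive.

Import Order.TTheory GRing.Theory Num.Theory.
Import numFieldNormedType.Exports.

Local Open Scope classical_set_scope.
Local Open Scope ring_scope.

(* Everything is set up over an arbitrary numFieldType K; the intended
   instances are K = R and K = R[i] for R : realType. In the library the norm
   of a normedModType K is K-valued, with nonnegative (hence real) values. *)

Definition separable (T : topologicalType) : Prop :=
  exists2 D : set T, countable D & dense D.

Section OperatorAlgebras.
Context {K : numFieldType} {E : normedModType K}.

(* B(E), carved out of the K-vector space E -> E (pointwise operations). *)
Definition bounded_operator : set (E -> E) :=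
  [set T | linear T /\ exists M : K, forall x, `|T x| <= M * `|x|].

(* Only meaningful for T in B(E). For K = R[i] the supremum is taken for the
   partial order of R[i]; on a bounded nonempty set of nonnegative elements it
   is the usual real supremum. *)
Definition opnorm (T : E -> E) : K :=
  supremum 0 [set `|T x| | x in [set x : E | `|x| <= 1]].

Definition opclosure (X : set (E -> E)) : set (E -> E) :=
  [set T | bounded_operator T /\
    forall eps : K, 0 < eps -> exists2 S, X S & opnorm (T - S) < eps].

Definition opclosed (X : set (E -> E)) : Prop := opclosure X `<=` X.

Definition finite_rank : set (E -> E) :=
  [set T | bounded_operator T /\
    exists (n : nat) (v : 'I_n -> E),
      forall x, exists c : 'I_n -> K, T x = \sum_(i < n) c i *: v i].

(* In the following definitions A stands for a norm-closed subalgebra of B(E),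
   with composition as product. *)

Definition has_right_approximate_identity (A : set (E -> E)) : Prop :=
  exists (D : Type) (le : D -> D -> Prop) (e : D -> E -> E),
    [/\ inhabited D,
        [/\ (forall i, le i i),
            (forall i j k, le i j -> le j k -> le i k) &
            (forall i j, exists k, le i k /\ le j k)],
        (forall i, A (e i)) &
        forall a, A a -> forall eps : K, 0 < eps ->
          exists i0, forall i, le i0 i -> opnorm (a \o e i - a) < eps].

Definition unital (A : set (E -> E)) : Prop :=
  exists2 u, A u & forall a, A a -> u \o a = a /\ a \o u = a.

(* When A has no identity, id is not in A, so that A + K id is a direct sum
   and is the algebra obtained from A by adjoining an identity. *)
Definition unitisation (A : set (E -> E)) : set (E -> E) :=
  [set s | (unital A /\ A s) \/
           (~ unital A /\ exists2 a, A a & exists l : K, s = a + l *: id)].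

Definition right_ideal (A I : set (E -> E)) : Prop :=
  [/\ I `<=` A,
      I 0,
      (forall x y, I x -> I y -> I (x + y)),
      (forall (l : K) x, I x -> I (l *: x)) &
      (forall x a, I x -> A a -> I (x \o a))].

Definition closed_right_ideal (A I : set (E -> E)) : Prop :=
  right_ideal A I /\ opclosed I.

Definition topologically_finitely_generated (A I : set (E -> E)) : Prop :=
  exists (n : nat) (x : 'I_n -> E -> E),
    (forall i, I (x i)) /\
    I = opclosure [set T | exists s : 'I_n -> E -> E,
          (forall i, unitisation A (s i)) /\ T = \sum_(i < n) (x i \o s i)].

Definition topologically_principal (A I : set (E -> E)) : Prop :=
  exists2 x, I x & I = opclosure [set x \o s | s in unitisation A].

Definition topologically_right_Noetherian (A : set (E -> E)) : Prop :=
  forall I, closed_right_ideal A I -> topologically_finitely_generated A I.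

End OperatorAlgebras.

Definition approximable {K : numFieldType} (E : normedModType K) :
  set (E -> E) := opclosure finite_rank.
Arguments approximable {K} E _.

(* Main.v *)
Require Import Defs.
From HB Require Import structures.
From mathcomp Require Import all_boot all_order all_algebra.
From mathcomp Require Import all_classical all_reals all_analysis.
From mathcomp Require Import ring lra.
Import Order.TTheory GRing.Theory Num.Theory.
Import numFieldNormedType.Exports.

Set Implicit Arguments.
Unset Strict Implicit.
Unset Printing Implicit Defensive.

Local Open Scope classical_set_scope.
Local Open Scope ring_scope.

(* Write y (x) f for the rank-one operator x |-> f x *: y. A closed right ideal
   I of A(E) determines the closed subspace V of those y with y (x) f in I for
   all bounded functionals f, and V contains the range of every T in I. If E is
   separable, V has a dense sequence y n, and some x in I has every y n in its
   range: x is a rapidly converging series of operators u n (x) f n, with u n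
   in V, arranged so that its values on the y n are triangular. For S in I and
   e far out in the right approximate identity, S is close to S o e, hence to a
   finite-rank operator with range in V, that is, to a finite sum of operators
   z (x) g with z in V; each of these is close to x o (w (x) g) with x w close
   to z, so x generates I. Conversely, if x_1, .., x_n generate the ideal A(E),
   rank-one operators show that the ranges of the x_i together span a dense
   subspace, and these ranges are separable because the x_i are approximable. *)

(** * Hahn-Banach *)

Section HahnBanach.
Context {R : realType} {V : lmodType R} {p : V -> R}.
Hypotheses (pD : forall x y, p (x + y) <= p x + p y)
  (pZ : forall a x, p (a *: x) = `|a| * p x).

(** Partial functionals are coded by their graphs. Domination makes them single-valued: the
    difference of two values over one point is at most [p 0 = 0]. *)
Let dominated (G : set (V * R)) : Prop :=
  (forall a u w, G u -> G w -> G (a *: u.1 + w.1, a * u.2 + w.2)) /\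
  (forall u, G u -> u.2 <= p u.1).

(** Every lower bound [w.2 - p (w.1 - y)] is at most every upper bound [p (u.1 + y) - u.2], so the
    supremum of the former is an admissible value at [y]. Homogeneity of [p] reduces the multiples
    [t *: y] to [t = 1] and [t = -1]. *)
Let extend_dominated (G : set (V * R)) (y : V) : G (0, 0) -> dominated G ->
  exists alpha : R,
    dominated [set (u.1 + t *: y, u.2 + t * alpha) | u in G & t in setT].
Proof.
move=> G0 [Glin Gdom].
have cross u w : G u -> G w -> w.2 - p (w.1 - y) <= p (u.1 + y) - u.2.
  move=> Gu Gw; have := Gdom _ (Glin 1 _ _ Gu Gw).
  rewrite /= scale1r mul1r => h.
  have := pD (u.1 + y) (w.1 - y); rewrite addrACA subrr addr0; lra.
pose S := [set w.2 - p (w.1 - y) | w in G].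
have S0 : S !=set0 by exists (0 - p (0 - y)), (0, 0).
pose alpha := sup S.
have upper u : G u -> u.2 + alpha <= p (u.1 + y).
  move=> Gu; suff : alpha <= p (u.1 + y) - u.2 by lra.
  by apply: ge_sup => // _ [w Gw <-]; exact: cross.
have lower w : G w -> w.2 - alpha <= p (w.1 - y).
  move=> Gw; suff : w.2 - p (w.1 - y) <= alpha by lra.
  apply: ub_le_sup; last by exists w.
  by exists (p (0 + y) - 0) => _ [w' Gw' <-]; exact: (cross (0, 0)).
exists alpha; split.
  move=> a _ _ [u Gu [t _ <-]] [w Gw [s _ <-]] /=.
  exists (a *: u.1 + w.1, a * u.2 + w.2); first exact: Glin.
  exists (a * t + s) => //=.
  by congr pair; [rewrite scalerDr scalerDl scalerA addrACA|ring].
move=> _ [u Gu [t _ <-]] /=.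
have Gs c : G (c *: u.1, c * u.2).
  by have := Glin c _ _ Gu G0; rewrite /= !addr0.
have scaled c z : 0 < c ->
    p (u.1 + (c * z) *: y) = c * p (c^-1 *: u.1 + z *: y).
  move=> c0; have := pZ c (c^-1 *: u.1 + z *: y).
  by rewrite gtr0_norm// scalerDr !scalerA divff ?gt_eqF// scale1r.
have [t0|t0|->] := ltgtP t 0; last by rewrite scale0r mul0r !addr0; exact: Gdom.
- have /= := lower _ (Gs (- t)^-1).
  rewrite -(@ler_pM2l _ (- t)) ?oppr_gt0// -scaleN1r -scaled ?oppr_gt0//.
  rewrite mulrBr mulrA divff ?oppr_eq0 ?lt_eqF// mul1r mulrN1 opprK.
  by rewrite mulNr opprK.
- have /= := upper _ (Gs t^-1).
  rewrite -(@ler_pM2l _ t)// -[X in _ <= t * p (_ + X)]scale1r -scaled// mulr1.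
  by rewrite mulrDr mulrA divff ?gt_eqF// mul1r.
Qed.

(** Zorn's lemma runs over the sets [A] whose union with [L], the line through [(v, p v)], is
    dominated; adjoining [L] keeps the union of the empty chain admissible. *)
Lemma hahn_banach_seminorm (v : V) :
  exists f : V -> R, [/\ scalar f, f v = p v & forall x, f x <= p x].
Proof.
have p0 : p 0 = 0 by rewrite -(scale0r 0) pZ normr0 mul0r.
pose L := [set (a *: v, a * p v) | a in (setT : set R)].
have L0 : L (0, 0) by exists 0; rewrite ?scale0r ?mul0r.
have Ldom : dominated L.
  split=> [a _ _ [b _ <-] [c _ <-]|_ [a _ <-]] /=.
    by exists (a * b + c) => //; congr pair; rewrite ?scalerDl ?scalerA//; ring.
  rewrite pZ ler_wpM2r ?ler_norm//.
  have := pD v (-1 *: v); rewrite pZ normrN1 mul1r scaleN1r subrr p0; lra.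
have [|A [Adom Amax]] := @Zorn_bigcup _ (fun A => dominated (A `|` L)).
  move=> F FP Ftot.
  (* Any two points lie in one dominated set [X] together with [L]; [set0] serves when both come
     from [L]. *)
  have common u w : (\bigcup_(X in F) X `|` L) u ->
      (\bigcup_(X in F) X `|` L) w ->
      exists X, [/\ X `<=` \bigcup_(X in F) X, dominated (X `|` L),
        (X `|` L) u & (X `|` L) w].
    have incl X : F X -> X `<=` \bigcup_(X in F) X by move=> FX z Xz; exists X.
    move=> [[X FX Xu]|Lu] [[Y FY Yw]|Lw].
    - have [XY|YX] := Ftot _ _ FX FY.
      + exists Y; split; [exact: incl|exact: FP|left; exact: XY|by left].
      + exists X; split; [exact: incl|exact: FP|by left|left; exact: YX].
    - by exists X; split; [exact: incl|exact: FP|left|right].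
    - by exists Y; split; [exact: incl|exact: FP|right|left].
    - by exists set0; split; rewrite ?set0U.
  split=> [a u w Uu Uw|u Uu].
    have [X [XU [Xlin _] Xu Xw]] := common _ _ Uu Uw.
    by have [/XU|] := Xlin a _ _ Xu Xw; [left|right].
  by have [X [_ [_ Xdom] Xu _]] := common _ _ Uu Uu; exact: Xdom.
pose G := A `|` L.
have Gmax B : G `<=` B -> dominated B -> B `<=` G.
  move=> GB Bdom; apply: contrapT => nBG; apply: (Amax B).
    split; first by move=> z Az; apply: GB; left.
    by move=> BA; apply: nBG => z /BA; left.
  by rewrite setUidl// => z Lz; apply: GB; right.
have G0 : G (0, 0) by right.
(* By maximality the extension of [G] to [y] adds nothing, so [y] is already in the domain. *)
have /choice[f Gf] (y : V) : exists r, G (y, r).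
  have [alpha alphadom] := extend_dominated y G0 Adom.
  exists alpha; apply: (Gmax _ _ alphadom).
    move=> [x r] Gxr; exists (x, r) => //.
    by exists 0; rewrite //= scale0r mul0r !addr0.
  by exists (0, 0) => //; exists 1; rewrite //= scale1r mul1r !add0r.
have [Glin Gdom] := Adom.
have Gle x r s : G (x, r) -> G (x, s) -> s <= r.
  move=> Gr Gs; have := Gdom _ (Glin (-1) _ _ Gr Gs).
  by rewrite /= scaleN1r addNr p0 mulN1r addrC subr_le0.
have Gfun x r : G (x, r) -> f x = r.
  by move=> Gr; apply/eqP; rewrite eq_le !(@Gle x).
exists f; split=> [a x y||x].
- exact/Gfun/(Glin a _ _ (Gf x) (Gf y)).
- by apply: Gfun; right; exists 1; rewrite ?scale1r ?mul1r.
- exact: (Gdom _ (Gf x)).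
Qed.

End HahnBanach.

(** * Bounded and finite-rank operators *)

(* What the argument uses of the scalar field; both R and R[i] qualify. *)
Record real_or_complex (K : numFieldType) : Prop := RealOrComplex {
  nonneg_supremums : forall S : set K, S !=set0 -> S `<=` [set x | 0 <= x] ->
    has_ubound S -> supremums S !=set0;
  half_powers_small : forall eps : K, 0 < eps -> exists n, 2 ^- n < eps;
  countable_dense_scalars : exists q : nat -> K, forall c eps : K, 0 < eps ->
    exists n, `|c - q n| < eps }.

Section Linear.
Context {K : numFieldType} {U V : lmodType K} {T : U -> V}.
Hypothesis linT : linear T.

Lemma lin0 : T 0 = 0.
Proof.
have := linT 1 0 0; rewrite !scale1r addr0 => /eqP.
by rewrite -subr_eq0 opprD addNKr oppr_eq0 => /eqP.
Qed.

Lemma linZ a x : T (a *: x) = a *: T x.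
Proof. by have := linT a x 0; rewrite lin0 !addr0. Qed.

Lemma linD x y : T (x + y) = T x + T y.
Proof. by have := linT 1 x y; rewrite !scale1r. Qed.

Lemma linB x y : T (x - y) = T x - T y.
Proof. by rewrite linD -scaleN1r linZ scaleN1r. Qed.

End Linear.

Section Operators.
Context {K : numFieldType} {E : normedModType K}.
Implicit Types (T S : E -> E) (f : E -> K) (x y z v : E) (s : seq E).

Definition bounded_functional f : Prop :=
  scalar f /\ exists M : K, forall x, `|f x| <= M * `|x|.

(** The form in which Hahn-Banach enters the argument over a general [K]. *)
Definition separates_points : Prop :=
  forall v, v != 0 -> exists2 f, bounded_functional f & f v = 1.

Definition rank_one y f : E -> E := fun x => f x *: y.

(** Norm distance expressed pointwise, which avoids suprema in a partially ordered field;
    [opclosureP] links it to [opnorm]. *)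
Definition op_within (eps : K) T S : Prop :=
  forall x, `|T x - S x| <= eps * `|x|.

(** The given [M] may fail to be positive, or even comparable with 0 when [E] is trivial; [|M| + 1]
    is positive and can be divided by. *)
Lemma positive_bound (g : E -> K) :
  (exists M : K, forall x, `|g x| <= M * `|x|) ->
  exists2 M : K, 0 < M & forall x, `|g x| <= M * `|x|.
Proof.
move=> [M gM]; exists (`|M| + 1) => [|x]; first by rewrite ltr_wpDl.
have Mx : 0 <= M * `|x| := le_trans (normr_ge0 _) (gM x).
rewrite (le_trans (gM x))// -(ger0_norm Mx) normrM normr_id mulrDl mul1r.
by rewrite lerDl.
Qed.

Lemma bounded_operator_bound T : bounded_operator T ->
  exists2 M : K, 0 < M & forall x, `|T x| <= M * `|x|.
Proof.
move=> [_ [M TM]]; have [|N N0 TN] := @positive_bound (fun x => `|T x|).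
  by exists M => x; rewrite normr_id.
by exists N => // x; rewrite -[`|T x|]normr_id.
Qed.

Lemma bounded_functional_bound f : bounded_functional f ->
  exists2 M : K, 0 < M & forall x, `|f x| <= M * `|x|.
Proof. by move=> [_ /positive_bound]. Qed.

Lemma bounded_operator0 : bounded_operator (0 : E -> E).
Proof.
split=> [a x y|]; first by rewrite scaler0 addr0.
by exists 0 => x; rewrite normr0 mul0r.
Qed.

Lemma bounded_operator_id : bounded_operator (id : E -> E).
Proof. by split=> //; exists 1 => x; rewrite mul1r. Qed.

Lemma bounded_operator_lincomb (a : K) T S : bounded_operator T ->
  bounded_operator S -> bounded_operator (a *: T + S).
Proof.
move=> bT bS; have [linT _] := bT; have [linS _] := bS.
have [M M0 TM] := bounded_operator_bound bT.
have [N N0 SN] := bounded_operator_bound bS.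
split=> [b x y|].
  change (a *: T (b *: x + y) + S (b *: x + y) =
    b *: (a *: T x + S x) + (a *: T y + S y)).
  by rewrite linT linS !scalerDr !scalerA addrACA (mulrC a).
exists (`|a| * M + N) => x; rewrite mulrDl (le_trans (ler_normD _ _))//.
by rewrite normrZ lerD// -mulrA ler_wpM2l.
Qed.

Lemma bounded_operatorD T S : bounded_operator T -> bounded_operator S ->
  bounded_operator (T + S).
Proof.
by move=> bT bS; rewrite -[T]scale1r; exact: bounded_operator_lincomb.
Qed.

Lemma bounded_operatorZ (a : K) T : bounded_operator T ->
  bounded_operator (a *: T).
Proof.
move=> bT; rewrite -[_ *: _]addr0.
exact: bounded_operator_lincomb bounded_operator0.
Qed.

Lemma bounded_operatorB T S : bounded_operator T -> bounded_operator S ->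
  bounded_operator (T - S).
Proof.
by move=> bT bS; rewrite -[- S]scaleN1r addrC; exact: bounded_operator_lincomb.
Qed.

Lemma bounded_operator_comp T S : bounded_operator T -> bounded_operator S ->
  bounded_operator (T \o S).
Proof.
move=> bT bS; have [linT _] := bT; have [linS _] := bS.
have [M M0 TM] := bounded_operator_bound bT.
have [N N0 SN] := bounded_operator_bound bS.
split=> [a x y|] /=; first by rewrite linS linT.
by exists (M * N) => x; rewrite (le_trans (TM _))// -mulrA ler_pM2l.
Qed.

Lemma bounded_functional_comp f T : bounded_functional f ->
  bounded_operator T -> bounded_functional (f \o T).
Proof.
move=> bf bT; have [linT _] := bT; have [linf _] := bf.
have [M M0 fM] := bounded_functional_bound bf.
have [N N0 TN] := bounded_operator_bound bT.
split=> [a x y|] /=; first by rewrite linT linf.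
by exists (M * N) => x; rewrite (le_trans (fM _))// -mulrA ler_pM2l.
Qed.

Lemma bounded_rank_one y f : bounded_functional f ->
  bounded_operator (rank_one y f).
Proof.
move=> bf; have [linf _] := bf; have [M M0 fM] := bounded_functional_bound bf.
split=> [a x z|]; first by rewrite /rank_one linf scalerDl scalerA.
by exists (M * `|y|) => x; rewrite /rank_one normrZ mulrAC ler_wpM2r.
Qed.

Lemma op_withinD (a b : K) T1 T2 S1 S2 :
  op_within a T1 S1 -> op_within b T2 S2 ->
  op_within (a + b) (T1 + T2) (S1 + S2).
Proof.
move=> h1 h2 x; rewrite !fctE opprD addrACA mulrDl.
by rewrite (le_trans (ler_normD _ _))// lerD.
Qed.

Lemma op_within_trans (a b : K) T1 T2 T3 :
  op_within a T1 T2 -> op_within b T2 T3 -> op_within (a + b) T1 T3.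
Proof.
move=> h1 h2 x; rewrite -(subrK (T2 x) (T1 x)) -addrA mulrDl.
by rewrite (le_trans (ler_normD _ _))// lerD.
Qed.

Lemma op_within_compr (a M : K) T S b : 0 <= a ->
  (forall x, `|b x| <= M * `|x|) ->
  op_within a T S -> op_within (a * M) (T \o b) (S \o b).
Proof.
by move=> a0 bM h x /=; rewrite (le_trans (h _))// -mulrA ler_wpM2l.
Qed.

Lemma op_within_compl (a M : K) T S b : 0 <= M -> linear b ->
  (forall x, `|b x| <= M * `|x|) ->
  op_within a T S -> op_within (M * a) (b \o T) (b \o S).
Proof.
move=> M0 linb bM h x /=; rewrite -(linB linb) (le_trans (bM _))//.
by rewrite -mulrA ler_wpM2l.
Qed.

Section OperatorNorm.
Hypothesis Kok : real_or_complex K.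

(** [supremum] is a least upper bound only if one exists. [nonneg_supremums] supplies it: the values
    are nonnegative, include the norm of [T 0] and are bounded by [M]. *)
Let opnorm_sup T : bounded_operator T ->
  supremums [set `|T x| | x in [set x : E | `|x| <= 1]] (opnorm T).
Proof.
move=> bT; have [linT _] := bT; have [M M0 TM] := bounded_operator_bound bT.
set S := (X in supremums X); have S0 : S !=set0.
  by exists `|T 0|, 0; rewrite //= normr0.
have /= [|| u Su] := nonneg_supremums Kok S0.
- by move=> _ [x _ <-] /=.
- exists M => _ [x /= x1 <-]; rewrite (le_trans (TM x))//.
  by rewrite -[leRHS]mulr1 ler_pM2l.
rewrite /opnorm /supremum -/S ifF; last exact/negbTE/set0P.
by case: xgetP => [_ -> //|/(_ u)].
Qed.

Lemma opnorm_bound T x : bounded_operator T -> `|T x| <= opnorm T * `|x|.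
Proof.
move=> bT; have [Tub _] := opnorm_sup bT; have [linT _] := bT.
have [->|x0] := eqVneq x 0; first by rewrite (lin0 linT) !normr0 mulr0.
have xpos : 0 < `|x| by rewrite normr_gt0.
have : `|T (`|x|^-1 *: x)| <= opnorm T.
  apply: Tub; exists (`|x|^-1 *: x) => //=.
  by rewrite normrZ normfV normr_id mulVf ?gt_eqF.
by rewrite (linZ linT) normrZ normfV normr_id mulrC ler_pdivrMr.
Qed.

Lemma opnorm_le T (M : K) : bounded_operator T -> 0 <= M ->
  (forall x, `|T x| <= M * `|x|) -> opnorm T <= M.
Proof.
move=> bT M0 TM; have [_] := opnorm_sup bT; apply=> _ [x /= x1 <-].
by rewrite (le_trans (TM x))// -[leRHS]mulr1 ler_wpM2l.
Qed.

(** Halving [eps] turns the non-strict pointwise bound back into a strict inequality for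
    [opnorm]. *)
Lemma opclosureP (X : set (E -> E)) T : X `<=` bounded_operator ->
  opclosure X T <-> bounded_operator T /\
    forall eps : K, 0 < eps -> exists2 S, X S & op_within eps T S.
Proof.
move=> Xb; split=> -[bT TX]; split=> // eps eps0.
  have [S XS TS] := TX _ eps0; exists S => // x.
  have := opnorm_bound x (bounded_operatorB bT (Xb _ XS)).
  by move=> /le_trans; apply; rewrite ler_wpM2r// ltW.
have [S XS TS] := TX _ (divr_gt0 eps0 (ltr0n _ 2)); exists S => //.
apply: (@le_lt_trans _ _ (eps / 2)); last by rewrite gtr_pMr// invf_lt1// ltr1n.
by apply: opnorm_le => //; [exact/bounded_operatorB/Xb|rewrite divr_ge0// ltW].
Qed.

End OperatorNorm.

(** Peeling off one coefficient per entry lets proofs go by induction on the list, whose length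
    bounds the dimension. *)
Fixpoint in_span s z : Prop :=
  if s is v :: s' then exists c : K, in_span s' (z - c *: v) else z = 0.

Lemma in_span_lincomb (I : Type) (r : seq I) (c : I -> K) (v : I -> E) :
  in_span [seq v i | i <- r] (\sum_(i <- r) c i *: v i).
Proof.
elim: r => [|i r IH] /=; first by rewrite big_nil.
by exists (c i); rewrite big_cons addrAC subrr add0r.
Qed.

Lemma in_span_coords s z : in_span s z ->
  exists c : nat -> K, z = \sum_(i < size s) c i *: s`_i.
Proof.
elim: s z => [|v s IH] z /=.
  by move=> ->; exists (fun=> 0); rewrite big_ord0.
move=> [a /IH [c zE]]; exists (fun i => if i is j.+1 then c j else a).
by rewrite big_ord_recl /= -zE addrC subrK.
Qed.

Lemma in_span_linear a s x y :
  in_span s x -> in_span s y -> in_span s (a *: x + y).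
Proof.
elim: s x y => [|v s IH] x y /=; first by move=> -> ->; rewrite scaler0 addr0.
move=> [c xs] [d ys]; exists (a * c + d).
by rewrite scalerDl -scalerA opprD addrACA -scalerBr; exact: IH.
Qed.

Lemma in_span_cat s1 s2 x y :
  in_span s1 x -> in_span s2 y -> in_span (s1 ++ s2) (x + y).
Proof.
elim: s1 x => [|v s IH] x /=; first by move=> ->; rewrite add0r.
by move=> [c /IH h] /h; exists c; rewrite addrAC.
Qed.

Lemma in_span_map (g : E -> E) s z : linear g ->
  in_span s z -> in_span [seq g v | v <- s] (g z).
Proof.
move=> ling; elim: s z => [|v s IH] z /=; first by move=> ->; exact: lin0.
by move=> [c /IH h]; exists c; rewrite -(linZ ling) -(linB ling).
Qed.

Lemma finite_rankP T :
  finite_rank T <-> bounded_operator T /\ exists s, forall x, in_span s (T x).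
Proof.
split=> -[bT]; last first.
  move=> [s sT]; split=> //; exists (size s), (fun i => s`_i) => x.
  by have [c ->] := in_span_coords (sT x); exists (fun i => c i).
move=> [n [v vT]]; split=> //; exists [seq v i | i <- index_enum 'I_n] => x.
by have [c ->] := vT x; exact: in_span_lincomb.
Qed.

Lemma finite_rank0 : finite_rank (0 : E -> E).
Proof.
by apply/finite_rankP; split; [exact: bounded_operator0|exists [::]].
Qed.

Lemma finite_rankD T S : finite_rank T -> finite_rank S -> finite_rank (T + S).
Proof.
move=> /finite_rankP[bT [s sT]] /finite_rankP[bS [t tS]]; apply/finite_rankP.
split; first exact: bounded_operatorD.
by exists (s ++ t) => x; exact: in_span_cat.
Qed.

Lemma finite_rank_comp T S : finite_rank T -> bounded_operator S ->
  finite_rank (T \o S).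
Proof.
move=> /finite_rankP[bT [s sT]] bS; apply/finite_rankP.
by split; [exact: bounded_operator_comp|exists s => x; exact: sT].
Qed.

Lemma finite_rank_rank_one y f : bounded_functional f ->
  finite_rank (rank_one y f).
Proof.
move=> bf; apply/finite_rankP; split; first exact: bounded_rank_one.
by exists [:: y] => x; exists (f x); rewrite subrr.
Qed.

(** If [f] vanishes at the head [v], the tail is treated recursively. Otherwise the projection [g]
    along [v] kills [v] and fixes the kernel of [f], so the images of the tail span that kernel. *)
Lemma in_span_kernel s y f : scalar f -> in_span s y -> f y != 0 ->
  exists2 s', (size s' < size s)%N &
    forall z, in_span s z -> f z = 0 -> in_span s' z.
Proof.
move=> linf; have fB := @linB K E K^o f linf; have fZ := @linZ K E K^o f linf.
elim: s y => [|v s IH] y /=.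
  by move=> ->; rewrite (@lin0 K E K^o f linf) eqxx.
move=> [c sy] fy0; have [fv|fv] := eqVneq (f v) 0.
  have [|s' s's sub] := IH _ sy; first by rewrite fB fZ fv scaler0 subr0.
  exists (v :: s') => //= z [d sz] fz; exists d.
  by apply: sub => //; rewrite fB fZ fv scaler0 subr0.
pose g w := w - (f w / f v) *: v.
have ling : linear g.
  move=> a z w; rewrite /g linf mulrDl scalerDl opprD addrACA.
  by rewrite scalerBr scalerA mulrA.
exists [seq g w | w <- s] => [|z [d sz] fz]; first by rewrite size_map.
have := in_span_map ling sz; rewrite (linB ling) (linZ ling).
by rewrite /g fz mul0r scale0r divff// scale1r subrr scaler0 !subr0.
Qed.

(** Induction on the number of spanning vectors. With [y = T x0] in [V] and [f y = 1], subtracting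
    [rank_one y (f \o T)] pushes the range into the kernel of [f], which fewer vectors span, and
    keeps it inside [V]. *)
Lemma finite_rank_ind (V : set E) (P : (E -> E) -> Prop) :
  separates_points ->
  (forall a x y, V x -> V y -> V (a *: x + y)) ->
  P 0 -> (forall T S, P T -> P S -> P (T + S)) ->
  (forall y f, V y -> bounded_functional f -> P (rank_one y f)) ->
  forall T, finite_rank T -> (forall x, V (T x)) -> P T.
Proof.
move=> sepE Vlin P0 PD P1 T /finite_rankP[+ [s]].
have [n] := ubnP (size s); elim: n s T => // n IH s T /ltnSE sn bT sT VT.
have [T0|/existsNP[x0 /eqP Tx0]] := pselect (forall x, T x = 0).
  by rewrite (_ : T = 0) //; exact/funext.
set y := T x0; have [f bf fy] := sepE y Tx0; have [linf _] := bf.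
have [|s' s's sub] := in_span_kernel linf (sT x0).
  by rewrite fy oner_neq0.
have -> : T = (T - rank_one y (f \o T)) + rank_one y (f \o T) by rewrite subrK.
have bfT := bounded_functional_comp bf bT.
apply: PD; last exact: P1 (VT _) bfT.
have T'E x : (T - rank_one y (f \o T)) x = - f (T x) *: T x0 + T x.
  by rewrite addrC scaleNr.
apply: (IH s'); first exact: leq_trans s's sn.
- exact/bounded_operatorB/bounded_rank_one.
- move=> x; apply: sub; last first.
    by rewrite T'E linf fy mulr1 addNr.
  rewrite T'E.
  exact: in_span_linear.
- by move=> x; rewrite T'E; exact: Vlin.
Qed.

End Operators.

(** * Approximable operators *)

Section Approximable.
Context {K : numFieldType} {E : normedModType K}.
Hypothesis Kok : real_or_complex K.
Implicit Types (T S : E -> E) (f : E -> K) (x y z v : E).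

Lemma finite_rank_bounded : finite_rank `<=` @bounded_operator K E.
Proof. by move=> T []. Qed.

Lemma approximableP T : approximable E T <-> bounded_operator T /\
  forall eps : K, 0 < eps -> exists2 S, finite_rank S & op_within eps T S.
Proof. exact: (opclosureP Kok T finite_rank_bounded). Qed.

Lemma approximable_bounded : approximable E `<=` bounded_operator.
Proof. by move=> T []. Qed.

Lemma op_within_refl T (eps : K) : 0 <= eps -> op_within eps T T.
Proof. by move=> e0 x; rewrite subrr normr0 mulr_ge0. Qed.

Lemma finite_rank_approximable : finite_rank `<=` approximable E.
Proof.
move=> T fT; apply/approximableP; split; first exact: finite_rank_bounded.
by move=> eps e0; exists T => //; exact/op_within_refl/ltW.
Qed.

Lemma approximableD T S : approximable E T -> approximable E S ->
  approximable E (T + S).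
Proof.
move=> /approximableP[bT aT] /approximableP[bS aS]; apply/approximableP.
split=> [|eps e0]; first exact: bounded_operatorD.
have [T' fT' TT'] := aT _ (divr_gt0 e0 (ltr0n _ 2)).
have [S' fS' SS'] := aS _ (divr_gt0 e0 (ltr0n _ 2)).
exists (T' + S'); first exact: finite_rankD.
by rewrite (splitr eps); exact: op_withinD.
Qed.

Lemma approximable_comp T b : approximable E T -> bounded_operator b ->
  approximable E (T \o b).
Proof.
move=> /approximableP[bT aT] bb; have [M M0 bM] := bounded_operator_bound bb.
apply/approximableP; split=> [|eps e0]; first exact: bounded_operator_comp.
have [S fS TS] := aT _ (divr_gt0 e0 M0).
exists (S \o b); first exact: finite_rank_comp.
rewrite -(divfK (lt0r_neq0 M0) eps); apply: op_within_compr => //.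
by rewrite ltW// divr_gt0.
Qed.

Lemma approximableZ (a : K) T : approximable E T -> approximable E (a *: T).
Proof.
move=> aT; have [linT _] := approximable_bounded aT.
have -> : a *: T = T \o (a *: id) by apply/funext => x /=; rewrite (linZ linT).
exact/approximable_comp/bounded_operatorZ/bounded_operator_id.
Qed.

(** This allows the Noetherian condition to be applied to the whole algebra. *)
Lemma closed_right_ideal_approximable :
  closed_right_ideal (approximable E) (approximable E).
Proof.
split; last first.
  move=> T /(opclosureP Kok T approximable_bounded)[bT aT].
  apply/approximableP; split=> // eps e0.
  have [S /approximableP[_ aS] TS] := aT _ (divr_gt0 e0 (ltr0n _ 2)).
  have [S' fS' SS'] := aS _ (divr_gt0 e0 (ltr0n _ 2)).
  by exists S' => //; rewrite (splitr eps); exact: op_within_trans TS SS'.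
split=> //.
- exact/finite_rank_approximable/finite_rank0.
- exact: approximableD.
- exact: approximableZ.
- by move=> T S aT /approximable_bounded; exact: approximable_comp.
Qed.

End Approximable.

(** * Geometrically convergent sequences *)

Section GeometricSequences.
Context {K : numFieldType}.
Hypothesis Kok : real_or_complex K.

Lemma half_powers_squeeze (x b : K) : 0 <= x ->
  (forall n, x <= b * 2 ^- n) -> x = 0.
Proof.
move=> x0 xb; apply/eqP; rewrite eq_le x0 andbT; apply/ler_addgt0Pr => e e0.
have b0 : 0 <= b by have := le_trans x0 (xb 0%N); rewrite expr0 invr1 mulr1.
have b1 : 0 < b + 1 by rewrite ltr_wpDl.
have [n ne] := half_powers_small Kok (divr_gt0 e0 b1).
rewrite add0r (le_trans (xb n))// (@le_trans _ _ ((b + 1) * 2 ^- n))//.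
  by rewrite ler_wpM2r ?lerDl// invr_ge0 exprn_ge0.
by move: ne; rewrite ltr_pdivlMr// mulrC => /ltW.
Qed.

(** The differences sum to a geometric tail, so the sequence is Cauchy. The explicit error bound
    characterises the limit in later steps. *)
Lemma geometric_cvg (E : completeNormedModType K) (s : nat -> E) (b : K) :
  0 <= b -> (forall n, `|s n.+1 - s n| <= b * 2 ^- n) ->
  exists l, forall n, `|l - s n| <= (b * 2) * 2 ^- n.
Proof.
move=> b0 sb.
have half n : 2 ^- n.+1 = 2 ^- n / 2 :> K by rewrite exprS invfM mulrC.
have tail n k : `|s (n + k)%N - s n| <= (b * 2) * (2 ^- n - 2 ^- (n + k)).
  elim: k => [|k IH]; first by rewrite addn0 !subrr normr0 mulr0.
  rewrite addnS -(subrK (s (n + k)%N) (s _.+1)) -addrA.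
  rewrite (le_trans (ler_normD _ _))// (le_trans (lerD (sb _) IH))//.
  rewrite half le_eqVlt; apply/orP; left; apply/eqP; field.
  by rewrite !expf_neq0 ?pnatr_eq0.
have {}tail n m : (n <= m)%N -> `|s m - s n| <= (b * 2) * 2 ^- n.
  move=> nm; have := tail n (m - n)%N; rewrite subnKC// => /le_trans; apply.
  rewrite ler_wpM2l ?mulr_ge0// lerBlDr lerDl invr_ge0 exprn_ge0//.
have b2 : 0 < b * 2 + 1 by rewrite ltr_wpDl// mulr_ge0.
have /cauchy_cvgP scvg : cauchy (s n @[n --> \oo]).
  apply/cauchy_exP => e e0.
  have [n ne] := half_powers_small Kok (divr_gt0 e0 b2).
  exists (s n); exists n => //= m /= nm; rewrite -ball_normE /= distrC.
  rewrite (le_lt_trans (tail _ _ nm))//.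
  move: ne; rewrite ltr_pdivlMr// mulrC; apply: le_lt_trans.
  by rewrite ler_wpM2r ?lerDl// invr_ge0 exprn_ge0.
exists (lim (s n @[n --> \oo])) => n; apply/ler_addgt0Pr => e e0.
have /cvgrPdist_lt/(_ e e0)[m _ sm] := scvg.
have /= sl := sm (maxn n m) (leq_maxr _ _).
rewrite -(subrK (s (maxn n m)) (lim _)) -addrA [leRHS]addrC.
rewrite (le_trans (ler_normD _ _))// lerD ?(ltW sl)// tail ?leq_maxl//.
Qed.

End GeometricSequences.

(** * An operator with dense range in a given subspace *)

Section DenseRange.
Context {K : numFieldType} {E : completeNormedModType K}.
Hypotheses (Kok : real_or_complex K) (sepE : @separates_points K E).
Variables (V : set E) (y : nat -> E).
Hypotheses (V0 : V 0) (Vlin : forall a u v, V u -> V v -> V (a *: u + v))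
  (Vy : forall n, V (y n)).

Let sum_V (I : Type) (r : seq I) (c : I -> K) (u : I -> E) (P : pred I) :
  (forall i, P i -> V (u i)) -> V (\sum_(i <- r | P i) c i *: u i).
Proof.
by move=> Vu; elim/big_rec: _ => // i w Pi Vw; apply: Vlin => //; exact: Vu.
Qed.

(* h picks functionals with h v v = 1; each stage projects along the vector
   obtained from y n at the preceding stages, so that y n is then killed. *)
Fixpoint deflate (h : E -> E -> K) (n : nat) (z : E) : E :=
  if n is m.+1 then
    let v := deflate h m (y m) in
    deflate h m z - h v (deflate h m z) *: v
  else z.

(** [f n] vanishes at [y m] for [m < n], and [f n (y n) = 1] when [x n] is nonzero. Hence a weighted
    series of the [rank_one (x n) (f n)] is a finite sum at each [y m], and the triangular system
    can be solved to reach every [y n] exactly. *)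
Lemma operator_with_dense_range : exists (T : E -> E) (u : nat -> E)
    (f : nat -> E -> K),
  [/\ bounded_operator T, (forall n, V (u n)),
      (forall n, bounded_functional (f n)),
      (forall n, exists z, T z = y n) &
      forall eps : K, 0 < eps ->
        exists N, op_within eps T (\sum_(i < N) rank_one (u i) (f i))].
Proof.
have /choice[h hP] (v : E) : exists g : E -> K,
    bounded_functional g /\ (v != 0 -> g v = 1).
  have [->|v0] := eqVneq v 0; last by have [g bg gv] := sepE v0; exists g.
  exists (fun=> 0); split=> //; split.
    by move=> a x z; rewrite mulr0 addr0.
  by exists 0 => x; rewrite normr0 mul0r.
pose P := deflate h; pose x n := P n (y n); pose f n z := h (x n) (P n z).
have PS n z : P n.+1 z = P n z - f n z *: x n by [].
have bP n : bounded_operator (P n).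
  elim: n => [|n IH]; first exact: bounded_operator_id.
  have -> : P n.+1 = P n - rank_one (x n) (h (x n) \o P n) by exact/funext.
  have [bh _] := hP (x n).
  exact/bounded_operatorB/bounded_rank_one/bounded_functional_comp.
have bf n : bounded_functional (f n).
  by have [bh _] := hP (x n); exact: bounded_functional_comp bh (bP n).
have PE n z : P n z = z - \sum_(i < n) f i z *: x i.
  elim: n => [|n IH]; first by rewrite big_ord0 subr0.
  by rewrite PS IH big_ord_recr /= opprD addrA.
(* By [PE], [x n] is [y n] minus a combination of earlier [x i]. *)
have Vx n : V (x n).
  have [m] := ubnP n; elim: m n => // m IH n /ltnSE nm.
  rewrite /x PE addrC -sumrN; under eq_bigr do rewrite -scaleNr.
  rewrite -[X in _ + X]scale1r addrC; apply: Vlin => //.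
  by apply: sum_V => i _; apply: IH; exact: leq_trans (ltn_ord i) nm.
have Py m n : (m < n)%N -> P n (y m) = 0.
  elim: n => // n IH; rewrite ltnS leq_eqVlt => /orP[/eqP <-|/IH Pn].
    rewrite PS /f -/(x m); have [_ hx] := hP (x m).
    have [->|x0] := eqVneq (x m) 0; first by rewrite scaler0 subr0.
    by rewrite hx// scale1r subrr.
  have [[linh _] _] := hP (x n).
  by rewrite PS /f Pn (@lin0 K E K^o _ linh) scale0r subr0.
have fy m n : (m < n)%N -> f n (y m) = 0.
  move=> mn; have [[linh _] _] := hP (x n).
  by rewrite /f Py// (@lin0 K E K^o _ linh).
have /choice[M MP] n : exists M : K, 0 < M /\ forall z, `|f n z| <= M * `|z|.
  by have [M ? ?] := bounded_functional_bound (bf n); exists M.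
have M0 n : 0 < M n by have [] := MP n.
have fM n z : `|f n z| <= M n * `|z| by have [] := MP n.
(* The weight bounds the n-th term at [z] by the norm of [z] times [2 ^- n]; the [+ 1] covers
   [x n = 0]. *)
pose c n := 2 ^- n / (M n * (`|x n| + 1)).
have x1 n : 0 < `|x n| + 1 by rewrite ltr_wpDl.
have c0 n : 0 < c n by rewrite divr_gt0 ?invr_gt0 ?exprn_gt0 ?mulr_gt0.
pose s z n := \sum_(i < n) f i z *: (c i *: x i).
have sstep z n : `|s z n.+1 - s z n| <= `|z| * 2 ^- n.
  rewrite /s big_ord_recr /= addrAC subrr add0r 2!normrZ (gtr0_norm (c0 n)).
  rewrite (@le_trans _ _ ((M n * `|z|) * (c n * (`|x n| + 1))))//.
    have c0' := ltW (c0 n).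
    by apply: ler_pM => //; [exact: mulr_ge0|rewrite ler_wpM2l// lerDl].
  rewrite le_eqVlt; apply/orP; left; apply/eqP; rewrite /c; field.
  by rewrite expf_neq0 ?pnatr_eq0// !lt0r_neq0.
have /choice[T Ts] z : exists l, forall n, `|l - s z n| <= (`|z| * 2) * 2 ^- n.
  exact: (geometric_cvg Kok (normr_ge0 z) (sstep z)).
have slin a z w n : s (a *: z + w) n = a *: s z n + s w n.
  rewrite /s scaler_sumr -big_split /=; apply: eq_bigr => i _.
  by have [linf _] := bf i; rewrite linf scalerDl !scalerA.
(* [T] was obtained by choice, so its linearity has to come from uniqueness of the limit. *)
have limit_uniq z w (b : K) :
    (forall n, `|w - s z n| <= b * 2 ^- n) -> w = T z.
  move=> wb; apply/eqP; rewrite -subr_eq0 -normr_eq0; apply/eqP.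
  apply: (half_powers_squeeze Kok (b := b + `|z| * 2)) => // n.
  rewrite -(subrK (s z n) w) -addrA mulrDl (le_trans (ler_normD _ _))// lerD//.
  by rewrite distrC.
have linT : linear T.
  move=> a z w; apply/esym.
  apply: (limit_uniq _ _ (`|a| * (`|z| * 2) + `|w| * 2)) => n.
  rewrite slin opprD addrACA -scalerBr mulrDl.
  by rewrite (le_trans (ler_normD _ _))// lerD// normrZ -mulrA ler_wpM2l.
have bT : bounded_operator T.
  split=> //; exists 2 => z; have := Ts z 0%N.
  by rewrite /s big_ord0 subr0 expr0 invr1 mulr1 mulrC.
(* The series at [y m] stops after the term of index [m]. *)
have s_stable m k : s (y m) (m.+1 + k)%N = s (y m) m.+1.
  elim: k => [|k IH]; first by rewrite addn0.
  rewrite addnS /s big_ord_recr /= fy ?scale0r ?addr0 -?IH//.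
  by rewrite ltnS leq_addr.
have Ty m : T (y m) = s (y m) m.+1.
  apply/eqP; rewrite -subr_eq0 -normr_eq0; apply/eqP.
  apply: (half_powers_squeeze Kok (b := `|y m| * 2)) => // n.
  rewrite -(s_stable m n) (le_trans (Ts _ _))// ler_wpM2l ?mulr_ge0//.
  by rewrite lef_pV2 ?posrE ?exprn_gt0// ler_eXn2l ?ltr1n// leq_addl.
pose W := range T.
have Wlin a w w' : W w -> W w' -> W (a *: w + w').
  by move=> [z _ <-] [z' _ <-]; exists (a *: z + z') => //; exact: linT.
have W0 : W 0 by exists 0; rewrite // (lin0 linT).
have Wsum (g : nat -> K) n : (forall i, (i < n)%N -> W (x i)) ->
    W (\sum_(i < n) g i *: x i).
  move=> Wx; elim/big_rec: _ => // i w _ Ww.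
  by apply: Wlin => //; exact/Wx/ltn_ord.
(* [T (y n)] is [c n *: x n] plus a combination of earlier [x i], already in the range; dividing by
   [c n] isolates [x n]. *)
have Wx n : W (x n).
  have [m] := ubnP n; elim: m n => // m IH n /ltnSE nm.
  have [->|x0] := eqVneq (x n) 0; first exact: W0.
  have fyn : f n (y n) = 1 by have [_] := hP (x n); exact.
  have -> : x n = (c n)^-1 *: (- 1 *: (\sum_(i < n) (f i (y n) * c i) *: x i)
      + T (y n)) + 0.
    rewrite Ty /s big_ord_recr /= fyn scale1r scaleN1r.
    under [in X in _ + (X + _)]eq_bigr do rewrite scalerA.
    by rewrite addKr scalerA mulVf ?gt_eqF// scale1r addr0.
  apply: (Wlin _ _ _ _ W0); apply: Wlin; last by exists (y n).
  apply: (Wsum (fun i => f i (y n) * c i)) => i ilt.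
  by apply: IH; exact: leq_trans ilt nm.
(* As [P n.+1] kills [y n], the vector [y n] is a combination of [x 0, .., x n]. *)
have Wy n : W (y n).
  have := PE n.+1 (y n); rewrite Py// => /esym/eqP.
  by rewrite subr_eq0 => /eqP ->; apply: (Wsum (f^~ (y n))).
exists T, (fun n => c n *: x n), f; split=> //.
- by move=> n; rewrite -[_ *: _]addr0; exact: Vlin.
- by move=> n; have [z _ zy] := Wy n; exists z.
move=> eps e0; have [N Ne] := half_powers_small Kok (divr_gt0 e0 (ltr0n _ 2)).
exists N => z; rewrite (_ : (\sum_(i < N) _) z = s z N); last first.
  by rewrite fct_sumE.
rewrite (le_trans (Ts z N))// -mulrA mulrC ler_wpM2r//.
by move: Ne; rewrite ltr_pdivlMr// mulrC => /ltW.
Qed.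

End DenseRange.

(** * Closed right ideals *)

Section Separability.
Context {K : numFieldType} {E : normedModType K}.
Hypothesis Kok : real_or_complex K.

(** The dense set [D] may miss [V], so for each [d] in [D] and each [k] a point of [V] within
    [2 ^- k] of [d] is chosen if there is one, and some default point of [V] otherwise. *)
Lemma separable_dense_sequence (V : set E) : separable E -> V 0 ->
  exists y : nat -> E, (forall n, V (y n)) /\
    forall z (eps : K), V z -> 0 < eps -> exists n, `|z - y n| < eps.
Proof.
move=> [D /countable_injP[f finj] Dd] V0.
pose near (nk : nat * nat) w := V w /\
  exists d, [/\ D d, f d = nk.1 & `|d - w| < 2 ^- nk.2].
have /choice[y yP] (nk : nat * nat) : exists w, V w /\
    ((exists w', near nk w') -> near nk w).
  have [[w nw]|no] := pselect (exists w', near nk w'); last by exists 0.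
  by exists w; split=> //; case: nw.
exists (fun n => y (odflt (0, 0)%N (unpickle n))); split=> [n|z eps Vz e0].
  by have [] := yP (odflt (0, 0)%N (unpickle n)).
have [k ke] := half_powers_small Kok (divr_gt0 e0 (ltr0n _ 2)).
have [|d [/= zd Dd']] := Dd (ball z (2 ^- k)) _ (ball_open _ _).
  by exists z; apply: ballxx; rewrite invr_gt0 exprn_gt0.
move: zd; rewrite -ball_normE /= => zd.
have [_ [|_ [d' [Dd'' fd' d'y]]]] := yP (f d, k).
  by exists z; split=> //; exists d; split=> //; rewrite distrC.
exists (pickle (f d, k)); rewrite pickleK /=.
move: fd' d'y => /finj -> /=; rewrite ?inE// => dy.
rewrite -(subrK d z) -addrA (le_lt_trans (ler_normD _ _))// (splitr eps).
by rewrite ltrD// ?(lt_trans zd)// (lt_trans dy).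
Qed.

(** Totality is an induction principle for closed additive sets containing all multiples of the
    [v i]. The closure of the countably many combinations with coefficients among the [q n] is such
    a set. *)
Lemma separable_of_countable_total (C : countType) (v : C -> E) :
  (forall G : set E, (forall (c : K) i, G (c *: v i)) -> G 0 ->
    (forall x y, G x -> G y -> G (x + y)) ->
    (forall z, (forall eps : K, 0 < eps -> exists2 w, G w & `|z - w| < eps) ->
      G z) ->
    forall z, G z) ->
  separable E.
Proof.
move=> total; have [q qd] := countable_dense_scalars Kok.
pose comb (s : seq (nat * C)) := \sum_(p <- s) q p.1 *: v p.2.
pose G z := forall eps : K, 0 < eps -> exists s, `|z - comb s| < eps.
have allG : forall z, G z.
  apply: total.
  - move=> c i eps e0; have v1 : 0 < `|v i| + 1 by rewrite ltr_wpDl.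
    have [n cn] := qd c _ (divr_gt0 e0 v1); exists [:: (n, i)].
    rewrite /comb big_seq1 -scalerBl normrZ.
    move: cn; rewrite ltr_pdivlMr//; apply: le_lt_trans.
    by rewrite ler_wpM2l// lerDl.
  - by move=> eps e0; exists [::]; rewrite /comb big_nil subr0 normr0.
  - move=> x y Gx Gy eps e0.
    have [s xs] := Gx _ (divr_gt0 e0 (ltr0n _ 2)).
    have [t yt] := Gy _ (divr_gt0 e0 (ltr0n _ 2)).
    exists (s ++ t); rewrite /comb big_cat opprD addrACA (splitr eps).
    by rewrite (le_lt_trans (ler_normD _ _))// ltrD.
  - move=> z Gz eps e0.
    have [w Gw zw] := Gz _ (divr_gt0 e0 (ltr0n _ 2)).
    have [s ws] := Gw _ (divr_gt0 e0 (ltr0n _ 2)).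
    exists s; rewrite -(subrK w z) -addrA (splitr eps).
    by rewrite (le_lt_trans (ler_normD _ _))// ltrD.
exists (range comb).
  exact: (sub_countable (card_image_le comb setT) (countableP _)).
move=> O [z Oz] Oopen.
have /nbhs_ballP[e /= e0 zO] : nbhs z O by exact: open_nbhs_nbhs.
have [s zs] := allG z e e0; exists (comb s); split; last by exists s.
by apply: zO; rewrite -ball_normE.
Qed.

End Separability.

(** * Generators of closed right ideals *)

Section RightIdeals.
Context {K : numFieldType} {E : completeNormedModType K}.
Hypotheses (Kok : real_or_complex K) (sepE : @separates_points K E).

Local Notation A := (approximable E).

Lemma unitisation_bounded : unitisation A `<=` bounded_operator.
Proof.
move=> s [[_ /approximable_bounded//]|[_ [a /approximable_bounded ba [l ->]]]].
apply: bounded_operatorD => //.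
exact/bounded_operatorZ/bounded_operator_id.
Qed.

Lemma approximable_unitisation : A `<=` unitisation A.
Proof.
move=> a Aa; have [?|?] := pselect (unital A); first by left.
by right; split=> //; exists a => //; exists 0; rewrite scale0r addr0.
Qed.

Lemma bounded_operator_sum (I : Type) (r : seq I) (P : pred I)
    (T : I -> E -> E) :
  (forall i, P i -> bounded_operator (T i)) ->
  bounded_operator (\sum_(i <- r | P i) T i).
Proof.
by move=> bT; elim/big_ind: _ => //;
  [exact: bounded_operator0|exact: bounded_operatorD].
Qed.

Lemma principal_finitely_generated (I : set (E -> E)) :
  topologically_principal A I -> topologically_finitely_generated A I.
Proof.
move=> [x Ix IE]; exists 1%N, (fun=> x); split=> //.
rewrite [LHS]IE; congr opclosure; apply/seteqP; split=> T.
  by move=> [s As <-]; exists (fun=> s); rewrite big_ord1.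
by move=> [s [As ->]]; exists (s ord0); rewrite ?big_ord1.
Qed.

Lemma noetherian_separable :
  topologically_right_Noetherian A -> separable E.
Proof.
move=> /(_ _ (closed_right_ideal_approximable Kok))[n [x [Ax AE]]].
(* [F (i, k)] spans the range of a finite-rank operator within [2 ^- k] of [x i]; all entries of
   these lists form the countable total family. Indices past the end of a list give 0. *)
have /choice[F FP] (ik : 'I_n * nat) : exists s, exists2 S,
    (forall w, in_span s (S w)) & op_within (2 ^- ik.2) (x ik.1) S.
  have /(approximableP Kok)[_ /(_ (2 ^- ik.2))] := Ax ik.1.
  rewrite invr_gt0 exprn_gt0// => /(_ isT)[S /finite_rankP[_ [s sS]] xS].
  by exists s, S.
apply: (@separable_of_countable_total _ _ Kok ('I_n * nat * nat)%type
  (fun ikj => (F ikj.1)`_ikj.2)) => G Gv G0 GD Gcl.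
have Gspan ik w : in_span (F ik) w -> G w.
  move=> /in_span_coords[c ->]; elim/big_ind: _ => // j _.
  exact: (Gv _ (ik, nat_of_ord j)).
have Gx i w : G (x i w).
  apply: Gcl => eps e0; have w1 : 0 < `|w| + 1 by rewrite ltr_wpDl.
  have [k ke] := half_powers_small Kok (divr_gt0 e0 w1).
  have [S sS xS] := FP (i, k); exists (S w); first exact: Gspan (sS w).
  rewrite (le_lt_trans (xS w))//.
  move: ke; rewrite ltr_pdivlMr//; apply: le_lt_trans.
  by rewrite ler_wpM2l ?lerDl// invr_ge0 exprn_ge0.
move=> z; have [->//|z0] := eqVneq z 0.
(* Since [rank_one z f] fixes [z], approximating it by sums of [x i \o s i] and evaluating at [z]
   approximates [z] by sums of points in the ranges of the [x i]. *)
have [f bf fz] := sepE z0.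
have : A (rank_one z f).
  exact/(finite_rank_approximable Kok)/finite_rank_rank_one.
rewrite AE => /(opclosureP Kok)[|_ close].
  move=> _ [s [As ->]]; apply: bounded_operator_sum => i _.
  apply: bounded_operator_comp; first exact: approximable_bounded (Ax i).
  exact: unitisation_bounded.
apply: Gcl => eps e0; have z1 : 0 < `|z| + 1 by rewrite ltr_wpDl.
have [_ [s [_ ->]] /(_ z)] := close _ (divr_gt0 e0 z1).
rewrite /rank_one fz scale1r fct_sumE => zs.
exists (\sum_(i < n) (x i \o s i) z).
  by elim/big_ind: _ => // i _; exact: Gx.
rewrite (le_lt_trans zs)// mulrAC ltr_pdivrMr// ltr_pM2l//.
by rewrite ltrDl.
Qed.

Lemma separable_principal (I : set (E -> E)) :
  has_right_approximate_identity A -> separable E ->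
  closed_right_ideal A I -> topologically_principal A I.
Proof.
move=> [D [le [e [_ [lexx _ _] Ae eP]]]] sep.
move=> [[IA I0 ID IZ IM] Icl].
have Ib : I `<=` bounded_operator by move=> T /IA /approximable_bounded.
have {}Icl T : bounded_operator T ->
    (forall eps : K, 0 < eps -> exists2 S, I S & op_within eps T S) -> I T.
  by move=> bT TI; apply/Icl/(opclosureP Kok).
pose V y := forall f, bounded_functional f -> I (rank_one y f).
have V0 : V 0.
  move=> f bf; rewrite (_ : rank_one _ _ = 0)//.
  by apply/funext => x; rewrite /rank_one scaler0.
have Vlin a y z : V y -> V z -> V (a *: y + z).
  move=> Vy Vz f bf; rewrite (_ : rank_one _ _ =
    a *: rank_one y f + rank_one z f); last first.
    by apply/funext => x; rewrite /rank_one scalerDr scalerA mulrC -scalerA.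
  by apply: ID; [exact/IZ/Vy|exact: Vz].
have IV T : I T -> forall x, V (T x).
  move=> IT x f bf; have [linT _] := Ib _ IT.
  rewrite (_ : rank_one _ _ = T \o rank_one x f).
    apply: IM => //.
    exact/(finite_rank_approximable Kok)/finite_rank_rank_one.
  by apply/funext => z; rewrite /rank_one /= (linZ linT).
have [y [Vy yd]] := separable_dense_sequence Kok sep V0.
have [x [u [f [bx Vu bf xy xuf]]]] :=
  operator_with_dense_range Kok sepE V0 Vlin Vy.
have [linx _] := bx.
(* The partial sums lie in [I] because every [u i] is in [V], and [I] is closed. *)
have Ix : I x.
  apply: Icl => // eps /xuf[N xN]; eexists; last exact: xN.
  by elim/big_ind: _ => // i _; exact: Vu.
exists x => //; apply/seteqP; split; last first.
  move=> T /(opclosureP Kok)[|bT TX].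
    by move=> _ [s /unitisation_bounded bs <-]; exact: bounded_operator_comp.
  apply: Icl => // eps /TX[_ [s As <-] Ts]; exists (x \o s) => //.
  case: As => [[_ ?]|[_ [a Aa [l ->]]]]; first exact: IM.
  rewrite (_ : _ \o _ = (x \o a) + l *: x); last first.
    by apply/funext => z /=; rewrite (linD linx) (linZ linx).
  by apply: ID; [exact: IM|exact: IZ].
move=> S IS; have bS := Ib _ IS; have [M M0 SM] := bounded_operator_bound bS.
have [linS _] := bS.
apply/(opclosureP Kok).
  by move=> _ [s /unitisation_bounded bs <-]; exact: bounded_operator_comp.
split=> // eps eps0.
(* Some [y n] is within [eta / N] of [z], where [N] bounds [g], and [y n = x w] exactly;
   [rank_one w g] is then the required operator. *)
have xrank_one z g (eta : K) : V z -> bounded_functional g -> 0 < eta ->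
    exists2 a, A a & op_within eta (rank_one z g) (x \o a).
  move=> Vz bg eta0; have [N N0 gN] := bounded_functional_bound bg.
  have [n zn] := yd z _ Vz (divr_gt0 eta0 N0); have [w xw] := xy n.
  exists (rank_one w g).
    exact/(finite_rank_approximable Kok)/finite_rank_rank_one.
  move=> t; rewrite /rank_one /= (linZ linx) xw -scalerBr normrZ.
  rewrite (le_trans (ler_pM _ _ (gN t) (ltW zn)))//.
  rewrite [leLHS](_ : _ = eta * `|t|)//.
  by field; exact: lt0r_neq0.
have xfinite_rank T : finite_rank T -> (forall z, V (T z)) ->
    forall eta : K, 0 < eta -> exists2 a, A a & op_within eta T (x \o a).
  apply: (finite_rank_ind (P := fun T => forall eta : K, 0 < eta ->
    exists2 a, A a & op_within eta T (x \o a)) sepE Vlin).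
  - move=> eta eta0; exists 0.
      exact/(finite_rank_approximable Kok)/finite_rank0.
    rewrite (_ : x \o 0 = 0); first exact/op_within_refl/ltW.
    by apply/funext => t /=; rewrite (lin0 linx).
  - move=> T1 T2 h1 h2 eta eta0.
    have [a Aa T1a] := h1 _ (divr_gt0 eta0 (ltr0n _ 2)).
    have [b Ab T2b] := h2 _ (divr_gt0 eta0 (ltr0n _ 2)).
    exists (a + b); first exact: approximableD.
    rewrite (_ : x \o (a + b) = (x \o a) + (x \o b)); last first.
      by apply/funext => t /=; rewrite (linD linx).
    by rewrite (splitr eta); exact: op_withinD.
  - by move=> z g Vz bg eta; exact: xrank_one.
(* Error budget: a quarter of [eps] for passing from [S] to [S \o e i0], a quarter for replacing
   [e i0] by a finite-rank [g] within [eps / 2 / 2 / M], and half for approximating [S \o g] by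
   [x \o a]. *)
have e4 : 0 < eps / 2 / 2 by rewrite !divr_gt0.
have [i0 /(_ i0 (lexx i0)) Se] := eP _ (IA _ IS) _ e4.
have /(approximableP Kok)[be /(_ _ (divr_gt0 e4 M0))[g fg eg]] := Ae i0.
have Sg : op_within (eps / 2) S (S \o g).
  rewrite (splitr (eps / 2)); apply: (@op_within_trans _ _ _ _ _ (S \o e i0)).
    move=> z; rewrite distrC.
    have := opnorm_bound Kok z
      (bounded_operatorB (bounded_operator_comp bS be) bS).
    by move=> /le_trans; apply; rewrite ler_wpM2r// ltW.
  rewrite -{1}(divfK (lt0r_neq0 M0) (eps / 2 / 2)) mulrC.
  by apply: op_within_compl => //; exact: ltW.
have fSg : finite_rank (S \o g).
  apply/finite_rankP; have [bg [s sg]] := (finite_rankP _).1 fg.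
  split; first exact: bounded_operator_comp.
  by exists [seq S v | v <- s] => z; exact: in_span_map.
have [a Aa Sga] := xfinite_rank _ fSg (fun z => IV _ IS (g z)) _
  (divr_gt0 eps0 (ltr0n _ 2)).
exists (x \o a); first by exists a => //; exact: approximable_unitisation.
by rewrite (splitr eps); exact: op_within_trans Sg Sga.
Qed.

Lemma noetherian_tfae : has_right_approximate_identity A ->
  [<-> topologically_right_Noetherian A;
       forall I, closed_right_ideal A I -> topologically_principal A I;
       separable E].
Proof.
move=> rai; tfae.
- by move=> /noetherian_separable sep I; exact: separable_principal.
- move=> prin; apply: noetherian_separable => I /prin.
  exact: principal_finitely_generated.
- move=> sep I cI; apply: principal_finitely_generated.
  exact: separable_principal.
Qed.

End RightIdeals.

(** * Real and complex scalars *)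

Section Scalars.
Context {R : realType}.

Let half_small (eps : R) : 0 < eps -> exists n, 2 ^- n < eps.
Proof.
move=> e0; exists (Num.bound eps^-1).
rewrite invf_plt ?posrE ?exprn_gt0//.
exact: upper_nthrootP (leqnn _).
Qed.

Let rat_dense (c eps : R) : 0 < eps -> exists a : rat, `|c - ratr a| < eps.
Proof.
move=> e0.
have [|r [/= rB [a _ ar]]] := @dense_rat R (ball c eps) _ (ball_open _ _).
  by exists c; exact: ballxx.
by exists a; rewrite ar; move: rB; rewrite -ball_normE.
Qed.

Lemma real_scalars : real_or_complex R.
Proof.
split.
- move=> S S0 _ Sub; exists (sup S); split=> [x Sx|M MS].
    exact: ub_le_sup.
  exact: ge_sup.
- exact: half_small.
- exists (fun n => ratr (odflt 0 (unpickle n : option rat))) => c eps e0.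
  by have [a ca] := rat_dense c e0; exists (pickle a); rewrite pickleK.
Qed.

Lemma normc_le (a b : R) : `|(a +i* b)%C| <= (`|a| + `|b|)%:C%C.
Proof.
have -> : (a +i* b = a%:C + b%:C * 'i)%C by simpc.
rewrite (le_trans (ler_normD _ _))// normrM !normc_def /=.
by rewrite !expr0n !addr0 add0r expr1n sqrtr1 mulr1 !sqrtr_sqr rmorphD.
Qed.

(** Nonnegative complex numbers are real, so suprema and small [eps] reduce to real parts; pairs of
    rationals give the dense sequence. *)
Lemma complex_scalars : real_or_complex R[i].
Proof.
have re0 (x : R[i]) : 0 <= x -> x = (complex.Re x)%:C%C.
  by move=> /ger0_real /RRe_real.
split.
- move=> S [x0 Sx0] Spos [M MS]; pose S' := [set complex.Re x | x in S].
  have S'0 : S' !=set0 by exists (complex.Re x0), x0.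
  have MR (N : R[i]) : ubound S N -> ubound S' (complex.Re N).
    by move=> NS _ [x Sx <-]; have := NS _ Sx; rewrite lecE => /andP[].
  exists (sup S')%:C%C; split=> [x Sx|N NS].
    rewrite (re0 x (Spos _ Sx)) lecR ub_le_sup//; last by exists x.
    by exists (complex.Re M); exact: MR.
  (* An upper bound [N] is real because it dominates the nonnegative [x0]. *)
  rewrite (re0 N); last exact: le_trans (Spos _ Sx0) (NS _ Sx0).
  by rewrite lecR ge_sup//; exact: MR.
- move=> eps e0; have epsE := re0 _ (ltW e0).
  move: e0; rewrite epsE (ltcR 0) => /half_small[n ne]; exists n.
  rewrite epsE -ltcR rmorphV/= ?unitfE ?expf_neq0// in ne *.
  by rewrite rmorphXn/= rmorph_nat in ne.
- exists (fun n =>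
    let: (a, b) := odflt (0, 0) (unpickle n : option (rat * rat)) in
    ((ratr a : R) +i* (ratr b : R))%C) => -[a b] eps e0.
  have epsE := re0 _ (ltW e0).
  have e2 : 0 < complex.Re eps / 2 by rewrite divr_gt0// -(ltcR 0) -epsE.
  have [p ap] := rat_dense a e2; have [q bq] := rat_dense b e2.
  exists (pickle (p, q)); rewrite pickleK /=.
  have -> : ((a +i* b) - (ratr p +i* ratr q) =
      (a - ratr p) +i* (b - ratr q))%C by [].
  by rewrite (le_lt_trans (normc_le _ _))// epsE ltcR; lra.
Qed.

Lemma real_separates_points (E : normedModType R) : @separates_points _ E.
Proof.
move=> v v0; have [f [linf fv fle]] :=
  @hahn_banach_seminorm R E (fun x => `|x|) (@ler_normD _ _) (@normrZ _ _) v.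
have nv : `|v| != 0 by rewrite normr_eq0.
exists (fun x => f x / `|v|); last by rewrite fv divff.
split=> [a x y|]; first by rewrite linf mulrDl mulrA.
exists `|v|^-1 => x; rewrite normrM normfV normr_id mulrC ler_wpM2l ?invr_ge0//.
have := fle (- x); rewrite normrN -scaleN1r (@linZ R E R^o f linf) => Nfx.
by rewrite ler_norml fle andbT lerNl -mulN1r.
Qed.

End Scalars.

(** * Restriction of scalars from complex to real *)

Section Realification.
Context {R : realType}.

(** The alias carries the real module structure, so that it does not clash with the complex one on
    [E]. *)
Definition realified (E : lmodType R[i]) : Type := E.

Variable E : lmodType R[i].

HB.instance Definition _ := GRing.Zmodule.on (realified E).

Let real_scale (a : R) (x : realified E) : realified E := a%:C%C *: (x : E).

Let real_scaleA a b x : real_scale a (real_scale b x) = real_scale (a * b) x.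
Proof. by rewrite /real_scale scalerA -rmorphM. Qed.

Let real_scale1 : left_id 1 real_scale.
Proof. by move=> x; rewrite /real_scale scale1r. Qed.

Let real_scaleDr : right_distributive real_scale +%R.
Proof. by move=> a x y; rewrite /real_scale scalerDr. Qed.

Let real_scaleDl x : {morph real_scale^~ x : a b / a + b}.
Proof. by move=> a b; rewrite /real_scale rmorphD/= scalerDl. Qed.

HB.instance Definition _ := GRing.Zmodule_isLmodule.Build R (realified E)
  real_scaleA real_scale1 real_scaleDr real_scaleDl.

End Realification.

Section ComplexScalars.
Context {R : realType}.

(** A real functional [f] dominated by the norm is complexified to [g x = f x - i f (i x)]. The real
    part of [g v] is the norm of [v], so [g] can be divided by [g v]. *)
Lemma complex_separates_points (E : normedModType R[i]) : @separates_points _ E.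
Proof.
move=> v v0; pose p (x : realified E) : R := complex.Re `|x : E|.
have pE (x : E) : `|x| = (p x)%:C%C by rewrite RRe_real// ger0_real.
have pD x y : p (x + y) <= p x + p y.
  by rewrite -lecR rmorphD/= -!pE ler_normD.
have pZ (a : R) (x : realified E) : p (a *: x) = `|a| * p x.
  apply: complexI; rewrite rmorphM/= -!pE normrZ; congr (_ * _).
  by rewrite normc_def /= expr0n addr0 sqrtr_sqr.
have [f [linf fv fle]] := hahn_banach_seminorm pD pZ v.
have fabs x : `|f x| <= p x.
  rewrite ler_norml fle andbT lerNl.
  have : p (- x) = p x by apply: complexI; rewrite -!pE normrN.
  have := fle (- x); rewrite -[in f _]scaleN1r.
  by rewrite (@linZ R (realified E) R^o f linf) scaleN1r => + <-.
have fD := @linD R (realified E) R^o f linf.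
have fZ := @linZ R (realified E) R^o f linf.
pose I x : E := 'i%C *: x.
have fC (a : R[i]) (x : E) :
    f (a *: x) = complex.Re a * f x + complex.Im a * f (I x).
  have -> : a *: x = (complex.Re a : R) *: (x : realified E) +
      (complex.Im a : R) *: (I x : realified E).
    change (a *: x =
      (complex.Re a)%:C%C *: x + (complex.Im a)%:C%C *: ('i%C *: x)).
    by rewrite scalerA -scalerDl mulrC -complexE.
  by rewrite fD !fZ.
pose g (x : E) : R[i] := (f x +i* (- f (I x)))%C.
have ling : scalar g.
  move=> a x y; have Ilin : I (a *: x + y) = ('i%C * a) *: x + I y.
    by rewrite /I scalerDr scalerA.
  rewrite /g Ilin (fD (a *: x)) (fD (('i%C * a) *: x)) (fC a) (fC ('i%C * a)).
  move: (f x) (f y) (f (I x)) (f (I y)) => fx fy fIx fIy.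
  case: a {Ilin} => a b; apply/eqP; rewrite eq_complex /=; apply/andP.
  by split; apply/eqP; ring.
have pI x : p (I x) = p x.
  apply: complexI; rewrite -!pE normrZ normc_def /=.
  by rewrite expr0n add0r expr1n sqrtr1 mul1r.
have gle x : `|g x| <= 2 * `|x|.
  have -> : 2 * `|x| = (2 * p x)%:C%C by rewrite rmorphM/= rmorph_nat pE.
  rewrite (le_trans (normc_le _ _))// lecR normrN.
  by rewrite mulr_natl mulr2n lerD// -pI.
have gv : g v != 0.
  apply: contra v0; rewrite eq_complex /= => /andP[/eqP fv0 _].
  by rewrite -normr_eq0 pE -fv fv0.
exists (fun x => g x / g v); last by rewrite divff.
split=> [a x y|]; first by rewrite ling mulrDl mulrA.
exists (2 / `|g v|) => x; rewrite normrM normfV mulrAC.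
by rewrite ler_wpM2r ?invr_ge0.
Qed.

End ComplexScalars.

Theorem theorem4p9 (R : realType) :
  (forall E : completeNormedModType R,
     has_right_approximate_identity (approximable E) ->
     [<-> topologically_right_Noetherian (approximable E);
          forall I, closed_right_ideal (approximable E) I ->
            topologically_principal (approximable E) I;
          separable E]) /\
  (forall E : completeNormedModType R[i],
     has_right_approximate_identity (approximable E) ->
     [<-> topologically_right_Noetherian (approximable E);
          forall I, closed_right_ideal (approximable E) I ->
            topologically_principal (approximable E) I;
          separable E]).
Proof.
split=> E.
  exact: (noetherian_tfae real_scalars (@real_separates_points R E)).
exact: (noetherian_tfae complex_scalars (@complex_separates_points R E)).
Qed.
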